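(* Let $0<q<\infty$ and let $P>q$ be given. There is a radial variable exponent $p(r)\ge q$ on $\mathbb{D}$ such that $\limsup_{r\to1^-}p(r)=P$ and $A^{p(\cdot)}=A^q$ (as sets).
   Context: $dA$ is normalized Lebesgue area measure on the open unit disc $\mathbb{D}$. A variable exponent is a measurable function $p$ on $\mathbb{D}$ with $0<\operatorname{ess\,inf}p\le\operatorname{ess\,sup}p<\infty$; it is radial if $p(z)=p(|z|)$, and then $p(r)$ denotes its value on $|z|=r$. $A^{p(\cdot)}$ is the space of analytic $f$ on $\mathbb{D}$ with $\int_{\mathbb{D}}|f(z)|^{p(z)}dA(z)<\infty$, and $A^q$ is the same space with constant exponent $q$. *)

(* Defs.v *)
From mathcomp Require Import all_boot all_order all_algebra.
From mathcomp Require Import all_classical all_reals all_analysis.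
From mathcomp Require Import measurable_realfun ess_sup_inf complex.
Set Implicit Arguments.
Unset Strict Implicit.
Unset Printing Implicit Defensive.
Import Order.TTheory GRing.Theory Num.Theory.
Import numFieldNormedType.Exports.
Local Open Scope classical_set_scope.
Local Open Scope ring_scope.

Section Bergman.
Context {R : realType}.
Local Open Scope complex_scope.

Implicit Types (f : R[i] -> R[i]) (p : R[i] -> R).

Definition unit_disc : set R[i] := [set z | `|z| < 1].

(* The plane carries its product Borel structure on R * R, and is identified
   with R[i] through this map. *)
Definition cplx (w : R * R) : R[i] := w.1 +i* w.2.

Definition disc2 : set (measurableTypeR R * measurableTypeR R) :=
  cplx @^-1` unit_disc.

Lemma disc2E : disc2 = [set w | w.1 ^+ 2 + w.2 ^+ 2 < 1].
Proof.
apply/seteqP; split => -[x y];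
  rewrite /disc2 /unit_disc /cplx /= normc_def ltcR /= => h.
- by rewrite -ltr_sqrt ?sqrtr1.
- by rewrite -[ltRHS]sqrtr1 ltr_sqrt.
Qed.

Lemma measurable_disc2 : measurable disc2.
Proof.
rewrite disc2E -[X in measurable X]setTI.
have mf : measurable_fun [set: measurableTypeR R * measurableTypeR R]
    (fun w => w.1 ^+ 2 + w.2 ^+ 2 : R).
  by apply: measurable_funD; apply: measurable_funX;
    [exact: measurable_fst|exact: measurable_snd].
have := mf measurableT `]-oo, 1[%classic (measurable_itv _).
by congr (measurable (_ `&` _)); apply/seteqP; split => w /=; rewrite in_itv.
Qed.

Definition dA : {measure set (measurableTypeR R * measurableTypeR R) -> \bar R} :=
  mscale (NngNum (ltW (divr_gt0 ltr01 (pi_gt0 R))))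
    (mrestr (lebesgue_measure \x lebesgue_measure)%E measurable_disc2).

(* R[i]^o is R[i] with the topology of its modulus. *)
Definition analytic_on (D : set R[i]) f : Prop :=
  forall z0 : R[i]^o, D z0 -> exists a : nat -> R[i],
    \forall z \near z0,
      series (fun n => a n * (z - z0) ^+ n : R[i]^o) @ \oo --> (f z : R[i]^o).

Definition variable_exponent p : Prop :=
  [/\ measurable_fun disc2 (p \o cplx),
      (0 < ess_inf dA (fun w => (p (cplx w))%:E))%E &
      (ess_sup dA (fun w => (p (cplx w))%:E) < +oo)%E].

Definition radial p : Prop := forall z, unit_disc z -> p z = p `|z|.

Definition bergman p : set (R[i] -> R[i]) :=
  [set f | analytic_on unit_disc f /\
    (\int[dA]_w (Normc.normc (f (cplx w)) `^ p (cplx w))%:E < +oo)%E].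

(* Left neighbourhoods of 1 up to Lebesgue-null sets: the limit superior along
   this filter is the essential one. *)
Definition ess_at_left1 : set_system R :=
  [set V | exists2 U, (1 : R)^'- U & {ae lebesgue_measure, forall r, U r -> V r}].

End Bergman.

(* Main.v *)
Require Import Defs.
From mathcomp Require Import all_boot all_order all_algebra.
From mathcomp Require Import all_classical all_reals all_analysis.
From mathcomp Require Import measurable_realfun ess_sup_inf complex.
From mathcomp Require Import ring lra.
Set Implicit Arguments.
Unset Strict Implicit.
Unset Printing Implicit Defensive.
Import Order.TTheory GRing.Theory Num.Theory.
Import numFieldNormedType.Exports.
Import Normc HBNNSimple.
Local Open Scope classical_set_scope.
Local Open Scope ring_scope.
Local Open Scope complex_scope.

(** The exponent equals [P] on countably many annuli accumulating at the unit
    circle and [q] elsewhere, so its limit superior at the boundary is [P], and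
    the essential one as well because every annulus has positive area.
    Raising the exponent costs nothing for the inclusion of the variable space
    in the constant one, since [x ^ q <= x ^ p + 1] when [q <= p] and the disc
    has finite area.

    The converse rests on a growth estimate whose shape does not depend on the
    function: every [f] in [A^q] satisfies [|f z| <= C / (1 - |z|) ^ K] as soon
    as [K * q >= 2] ([bergman_growth]). Hence [|f| ^ P] is at most a constant
    depending on [f] times a number depending only on the annulus, and it is
    enough to choose the annuli so thin that these numbers, weighted by the
    areas, have a finite sum ([thin_annulus], [bergman_sub_ring]).

    The growth estimate comes from the maximum principle and treats all [q > 0]
    at once. For [rho < 1] let [w0] maximise
    [|f w| * (rho - |w|) ^ K] over the disc of radius [rho], and let [s] be half
    the distance from [w0] to the circle of radius [rho]. Within distance [s] of
    [w0], maximality bounds [|f|] by [2 ^ K * |f w0|]; the Schwarz lemma then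
    makes [f] vary so slowly that [|f| >= |f w0| / 2] on a square whose side is
    a fixed fraction of [s] ([half_peak]). So the integral of [|f| ^ q] controls
    [|f w0| ^ q * s ^ 2], hence the maximum, uniformly in [rho]
    ([disc_growth]).

    Analyticity enters through finite Taylor expansions with a remainder
    ([analytic_taylor]). The maximum principle needs only the second order one:
    if [|g| ^ 2 + ep * |w| ^ 2] had an interior maximum, averaging over the four
    points at distance [t] along the axes would make it grow by at least
    [ep * t ^ 2] up to [O(t ^ 3)], which is absurd ([max_principle]). The Schwarz
    lemma applies this to the difference quotient, which again has second order
    expansions ([schwarz]). *)

(** * The modulus on the complex numbers *)

Lemma normc_real (R : rcfType) (x : R) : normc x%:C = `|x|.
Proof. by rewrite /normc /= expr0n /= addr0 sqrtr_sqr. Qed.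

Lemma normc_ge0 (R : rcfType) (x : R[i]) : 0 <= normc x.
Proof. by case: x => a b; exact: sqrtr_ge0. Qed.

Lemma normc_gt0 (R : rcfType) (x : R[i]) : x != 0 -> 0 < normc x.
Proof.
by move=> x0; rewrite lt_neqAle normc_ge0 andbT eq_sym; apply: contra x0 => /eqP/eq0_normc ->.
Qed.

Lemma normc_sqr (R : rcfType) (a b : R) : normc (a +i* b) ^+ 2 = a ^+ 2 + b ^+ 2.
Proof. by rewrite sqr_sqrtr // addr_ge0 ?sqr_ge0. Qed.

Lemma normcX (R : rcfType) (x : R[i]) n : normc (x ^+ n) = normc x ^+ n.
Proof. by elim: n => [|n IH]; rewrite ?expr0 ?normc1// !exprS normcM IH. Qed.

Lemma normcB (R : rcfType) (x y : R[i]) : normc (x - y) = normc (y - x).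
Proof. by rewrite -opprB normcN. Qed.

Lemma le_normcB (R : rcfType) (x y : R[i]) : normc x - normc y <= normc (x - y).
Proof. by rewrite lerBlDr -{1}(subrK y x) le_normcD. Qed.

Lemma normc_le_re_im (R : realType) (x y : R) : normc (x +i* y) <= `|x| + `|y|.
Proof.
rewrite -[leRHS]ger0_norm ?addr_ge0// -[leRHS]sqrtr_sqr ler_sqrt ?sqr_ge0//.
by rewrite sqrrD !real_normK ?num_real// lerD2r lerDl mulrn_wge0// mulr_ge0.
Qed.

(** Extreme values are taken on compact sets of the product plane, whereas the
    estimates are about the modulus of a complex increment. *)
Lemma continuous_at_cplx (R : realType) (f : R[i] -> R) (w : R * R) :
  (forall e : R, 0 < e -> exists2 d : R, 0 < d &
     forall h, normc h < d -> `|f (cplx w + h) - f (cplx w)| < e) ->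
  {for w, continuous (f \o @cplx R)}.
Proof.
move=> H; apply/cvgrPdist_lt => e e0.
have [d d0 D] := H _ e0.
have d2 : 0 < d / 2 by rewrite divr_gt0.
near=> x.
rewrite distrC /=.
have -> : cplx x = cplx w + cplx (x.1 - w.1, x.2 - w.2).
  by rewrite /cplx /= [RHS]/GRing.add /=; congr (_ +i* _); ring.
apply: D; apply: le_lt_trans (normc_le_re_im _ _) _.
have : `|w - x| < d / 2 by near: x; exact: cvgr_dist_lt.
rewrite prod_normE gt_max /= => /andP[].
rewrite distrC (distrC w.2) => ? ?; lra.
Unshelve. all: by end_near.
Qed.

Lemma ler_dist_normc (R : rcfType) (x y : R[i]) : `|normc x - normc y| <= normc (x - y).
Proof. by rewrite ler_norml lerNl opprB le_normcB normcB le_normcB. Qed.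

Lemma continuous_normc (R : realType) : continuous (@normc R \o @cplx R).
Proof.
move=> w; apply: continuous_at_cplx => e e0; exists e => // h he.
by apply: le_lt_trans he; apply: le_trans (ler_dist_normc _ _) _; rewrite addrAC subrr add0r.
Qed.

Lemma disc_max (R : realType) (f : R[i] -> R) (s : R) : 0 <= s ->
  (forall w, normc (cplx w) <= s -> {for w, continuous (f \o @cplx R)}) ->
  exists2 w0, normc w0 <= s & forall w, normc w <= s -> f w <= f w0.
Proof.
move=> s0 H.
pose K := [set w : R * R | normc (cplx w) <= s].
have cK : compact K.
  have sK : K `<=` `[- s, s]%classic `*` `[- s, s]%classic.
    move=> [x y]; rewrite /K /cplx /= => nxy; split; rewrite /= in_itv /= -ler_norml.
      apply: le_trans nxy; rewrite -sqrtr_sqr ler_sqrt ?lerDl ?sqr_ge0//.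
      by rewrite addr_ge0 ?sqr_ge0.
    apply: le_trans nxy; rewrite -sqrtr_sqr ler_sqrt ?lerDr ?sqr_ge0//.
    by rewrite addr_ge0 ?sqr_ge0.
  apply: (subclosed_compact _ _ sK); last first.
    by apply: compact_setX; exact: segment_compact.
  rewrite (_ : K = (@normc R \o @cplx R) @^-1` [set x | x <= s])//.
  by apply: preimage_closed; [move=> ? _; exact: continuous_normc|exact: closed_le].
have [||w0] := @compact_EVT_max _ R (f \o @cplx R) K _ cK.
- by exists (0, 0); rewrite /K /= expr0n /= addr0 sqrtr0.
- by apply: continuous_in_subspaceT => w /set_mem; exact: H.
rewrite inE => Kw0 max0; exists (cplx w0) => // -[x y] nw.
by apply: (max0 (x, y)); rewrite inE.
Qed.

(** * Taylor expansions with remainder *)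

(** An expansion of order [m - 1] with a remainder [O(|h| ^ m)]. Only this trace
    of analyticity is used in the maximum principle, and unlike convergent
    series it passes to quotients by finite algebra. *)
Definition taylor (R : realType) (m : nat) (f : R[i] -> R[i]) (w : R[i]) :=
  exists (a : nat -> R[i]) (B d : R), [/\ 0 < d, 0 <= B & forall h, normc h < d ->
    normc (f (w + h) - \sum_(i < m) a i * h ^+ i) <= B * normc h ^+ m].

Lemma le_normc_sum (R : rcfType) (I : Type) (r : seq I) (P : pred I) (F : I -> R[i]) :
  normc (\sum_(i <- r | P i) F i) <= \sum_(i <- r | P i) normc (F i).
Proof.
elim/big_ind2: _ => [|x y z t xy zt|//]; first by rewrite normc0.
by apply: le_trans (le_normcD _ _) _; exact: lerD.
Qed.

Lemma taylor_coef0 (R : realType) m (f : R[i] -> R[i]) w (a : nat -> R[i]) (B d : R) : 0 < d ->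
  (forall h, normc h < d ->
    normc (f (w + h) - \sum_(i < m.+1) a i * h ^+ i) <= B * normc h ^+ m.+1) ->
  f w = a 0%N.
Proof.
move=> d0 /(_ 0); rewrite normc0 addr0 => /(_ d0).
rewrite expr0n mulr0 big_ord_recl expr0 mulr1 big1 => [|i _]; last first.
  by rewrite exprS mul0r mulr0.
rewrite addr0 => h.
by apply/eqP; rewrite -subr_eq0; apply/eqP/eq0_normc/le_anti; rewrite h normc_ge0.
Qed.

Lemma taylor_lipschitz (R : realType) m (f : R[i] -> R[i]) w : taylor m.+1 f w ->
  exists2 L : R, 0 <= L & exists2 d : R, 0 < d &
     forall h, normc h < d -> normc (f (w + h) - f w) <= L * normc h.
Proof.
move=> [a [B [d [d0 B0 H]]]].
have a0 := taylor_coef0 d0 H.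
exists (B + \sum_(i < m) normc (a i.+1)).
  by rewrite addr_ge0 ?sumr_ge0// => i _; exact: normc_ge0.
exists (Order.min d 1) => [|h]; first by rewrite lt_min d0 ltr01.
rewrite lt_min => /andP[hd h1].
have pow n : normc h ^+ n.+1 <= normc h.
  by rewrite exprS ler_piMr ?normc_ge0// exprn_ile1 ?normc_ge0// ltW.
pose S := \sum_(i < m) a i.+1 * h ^+ i.+1.
have -> : f (w + h) - f w = (f (w + h) - \sum_(i < m.+1) a i * h ^+ i) + S.
  by rewrite big_ord_recl expr0 mulr1 a0 opprD addrA subrK.
apply: le_trans (le_normcD _ _) _; rewrite mulrDl lerD//.
  by apply: le_trans (H _ hd) _; rewrite ler_wpM2l.
apply: le_trans (le_normc_sum _ _ _) _; rewrite mulr_suml ler_sum// => i _.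
by rewrite normcM normcX ler_wpM2l ?normc_ge0.
Qed.

Lemma taylor_continuous (R : realType) m (f : R[i] -> R[i]) w :
  taylor m.+1 f (cplx w) -> {for w, continuous (@normc R \o f \o @cplx R)}.
Proof.
move=> /taylor_lipschitz[L L0 [d d0 H]].
apply: (@continuous_at_cplx _ (@normc R \o f)) => e e0.
have L1 : 0 < L + 1 by lra.
exists (Order.min d (e / (L + 1))) => [|h]; first by rewrite lt_min d0 divr_gt0.
rewrite lt_min ltr_pdivlMr// => /andP[hd he]; apply: le_lt_trans (ler_dist_normc _ _) _.
apply: le_lt_trans (H _ hd) _.
by apply: le_lt_trans he; rewrite mulrC ler_wpM2l ?normc_ge0// lerDl.
Qed.

(** * The maximum principle and the Schwarz lemma *)

Definition cross (R : realType) (t : R) : seq R[i] :=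
  [:: t +i* 0; (- t) +i* 0; 0 +i* t; 0 +i* (- t)].

Lemma cross_norm (R : realType) (t : R) h : 0 <= t -> h \in cross t -> normc h = t.
Proof.
move=> t0; rewrite !inE => /or4P[]/eqP->;
 by rewrite /normc /= expr0n /= ?addr0 ?add0r ?sqrrN sqrtr_sqr ger0_norm.
Qed.

(** The sums of [h], of [h ^ 2] and of [conj h * h ^ 2] over the four points
    vanish, so the cross terms of the squared modulus cancel. *)
Lemma cross_mean_square (R : realType) (a b c : R[i]) (t : R) :
  \sum_(h <- cross t) normc (a + b * h + c * h ^+ 2) ^+ 2
    = 4 * (normc a ^+ 2 + normc b ^+ 2 * t ^+ 2 + normc c ^+ 2 * t ^+ 4).
Proof.
case: a b c => [a1 a2] [b1 b2] [c1 c2]; rewrite !big_cons big_nil.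
have E x y : (a1 +i* a2) + (b1 +i* b2) * (x +i* y) + (c1 +i* c2) * (x +i* y) ^+ 2 =
  (a1 + (b1 * x - b2 * y) + (c1 * (x ^+ 2 - y ^+ 2) - c2 * (2 * x * y))) +i*
  (a2 + (b1 * y + b2 * x) + (c1 * (2 * x * y) + c2 * (x ^+ 2 - y ^+ 2))).
  rewrite expr2; simpc; congr (_ +i* _); ring.
rewrite !E !normc_sqr; ring.
Qed.

(** The term [ep * |w| ^ 2] makes the maximised function strictly subharmonic, so
    that an interior maximum is excluded even where [g] is locally constant;
    [ep] is arbitrarily small in the end. *)
Lemma max_principle (R : realType) (g : R[i] -> R[i]) (s M : R) : 0 < s ->
  (forall w, normc w <= s -> taylor 3 g w) ->
  (forall w, normc w = s -> normc (g w) <= M) ->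
  forall w, normc w <= s -> normc (g w) <= M.
Proof.
move=> s0 Tg Mg w ws.
have M0 : 0 <= M.
  by apply: le_trans (Mg s%:C _); rewrite ?normc_ge0// normc_real gtr0_norm.
rewrite -(@ler_pXn2r _ 2)// ?nnegrE ?normc_ge0//.
apply/ler_addgt0Pr => e e0; pose ep := e / s ^+ 2.
have ep0 : 0 < ep by rewrite divr_gt0// exprn_gt0.
pose v (w : R[i]) := normc (g w) ^+ 2 + ep * normc w ^+ 2.
have [w0 w0s maxv] : exists2 w0, normc w0 <= s & forall w, normc w <= s -> v w <= v w0.
  apply: disc_max => [|z zs]; first exact: ltW.
  apply: cvgD; first by apply: cvgM; exact: (taylor_continuous (Tg _ zs)).
  by apply: cvgM; [exact: cvg_cst|apply: cvgM; exact: continuous_normc].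
have [w0lt|w0ge] := ltP (normc w0) s; last first.
  have w0E : normc w0 = s by apply/le_anti/andP.
  have : v w0 <= M ^+ 2 + e.
    rewrite /v w0E /ep divfK ?gt_eqF ?exprn_gt0// lerD2r.
    by rewrite ler_pXn2r// ?nnegrE ?normc_ge0// Mg.
  apply: le_trans; apply: le_trans (maxv _ ws); rewrite lerDl.
  by rewrite mulr_ge0 ?exprn_ge0 ?normc_ge0// ltW.
exfalso.
have [a [B [d [d0 B0 T]]]] := Tg _ w0s.
pose c := normc (a 0%N) + normc (a 1%N) + normc (a 2%N).
have c0 : 0 <= c by rewrite !addr_ge0 ?normc_ge0.
have cB0 : 0 <= c * B by rewrite mulr_ge0.
(* [c] bounds the Taylor polynomial, whose square loses at most
   [2 * c * B * t ^ 3] when replaced by [g]; [t] is small enough for the gain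
   [ep * t ^ 2] to win. *)
pose t := Order.min (Order.min 1 (d / 2))
  (Order.min (s - normc w0) (ep / (2 * (c * B) + 1) / 2)).
have D0 : 0 < 2 * (c * B) + 1 by lra.
have t0 : 0 < t.
  rewrite !lt_min ltr01 subr_gt0 w0lt /=; apply/andP.
  by split; [exact: divr_gt0|apply: divr_gt0 => //; exact: divr_gt0].
have /andP[/andP[t1 td] /andP[ts tep]] : ((t <= 1) && (t <= d / 2)) &&
  ((t <= s - normc w0) && (t <= ep / (2 * (c * B) + 1) / 2)) by rewrite -!le_min.
clearbody t.
have tep' : 2 * (c * B) * t < ep.
  move: tep; rewrite ler_pdivlMr// ler_pdivlMr// => tep.
  nra.
have step h : h \in cross t ->
  normc (a 0%N + a 1%N * h + a 2%N * h ^+ 2) ^+ 2 - 2 * (c * B) * t ^+ 3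
   + ep * normc (w0 + 1 * h + 0 * h ^+ 2) ^+ 2 <= v w0.
  move=> ht; have ht' := cross_norm (ltW t0) ht.
  rewrite mul1r mul0r addr0.
  apply: le_trans (maxv (w0 + h) _); last first.
    by apply: le_trans (le_normcD _ _) _; rewrite ht'; lra.
  rewrite lerD2r.
  have := T h; rewrite ht' => /(_ ltac:(lra)).
  rewrite !big_ord_recl big_ord0 /= expr0 mulr1 expr1 addr0 addrA => Th.
  set P := a 0%N + a 1%N * h + a 2%N * h ^+ 2 in Th *.
  have Pc : normc P <= c.
    have t2 : t ^+ 2 <= 1 by rewrite exprn_ile1// ltW.
    apply: le_trans (le_normcD _ _) _; rewrite lerD//.
      apply: le_trans (le_normcD _ _) _; rewrite lerD// normcM ht'.
      by rewrite ler_piMr ?normc_ge0.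
    by rewrite normcM normcX ht' ler_piMr ?normc_ge0.
  have := le_normcB P (g (w0 + h)); rewrite normcB => Pg.
  have {Pg Th} Pg := le_trans Pg Th.
  have g0 := normc_ge0 (g (w0 + h)); have P0 := normc_ge0 P.
  have Bt : 0 <= B * t ^+ 3 by rewrite mulr_ge0// exprn_ge0// ltW.
  rewrite -mulrA -mulrA.
  move: (B * t ^+ 3) (normc P) (normc (g _)) Bt Pg Pc g0 P0 => de x y *.
  have [yx|xy] := leP x y; first by nra.
  nra.
have S1 := step _ (mem_head _ _).
have /step S2 : (- t) +i* 0 \in cross t by rewrite !inE eqxx orbT.
have /step S3 : 0 +i* t \in cross t by rewrite !inE eqxx !orbT.
have /step S4 : 0 +i* (- t) \in cross t by rewrite !inE eqxx !orbT.
have := cross_mean_square (a 0%N) (a 1%N) (a 2%N) t.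
have := cross_mean_square w0 1 0 t.
rewrite normc0 normc1 /cross !big_cons !big_nil.
have ga := taylor_coef0 d0 T.
have := exprn_ge0 2 (normc_ge0 (a 1%N)).
have := exprn_ge0 2 (normc_ge0 (a 2%N)).
move: S1 S2 S3 S4; rewrite /v ga.
pose Q h := normc (a 0%N + a 1%N * h + a 2%N * h ^+ 2) ^+ 2.
pose N h := normc (w0 + 1 * h + 0 * h ^+ 2) ^+ 2.
rewrite -!/(Q _) -!/(N _).
move: (Q _) (Q _) (Q _) (Q _) (N _) (N _) (N _) (N _).
move=> q1 q2 q3 q4 n1 n2 n3 n4 S1 S2 S3 S4 A2 A1 EN EQ.
have t20 : 0 < t ^+ 2 by rewrite exprn_gt0.
have : 4 * ep * t ^+ 2 <= 8 * (c * B) * t ^+ 3.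
  have : ep * (n1 + n2 + n3 + n4) = ep * (4 * normc w0 ^+ 2 + 4 * t ^+ 2).
    congr (_ * _); lra.
  have : 0 <= normc (a 1%N) ^+ 2 * t ^+ 2 by rewrite mulr_ge0// ltW.
  have : 0 <= normc (a 2%N) ^+ 2 * t ^+ 4 by rewrite mulr_ge0// exprn_ge0// ltW.
  lra.
nra.
Qed.

Lemma taylor_weaken (R : realType) m (f : R[i] -> R[i]) w : taylor m.+1 f w -> taylor m f w.
Proof.
move=> [a [B [d [d0 B0 H]]]]; exists a, (B + normc (a m)), (Order.min d 1); split.
- by rewrite lt_min d0 ltr01.
- by rewrite addr_ge0 ?normc_ge0.
move=> h; rewrite lt_min => /andP[hd h1].
have -> : f (w + h) - \sum_(i < m) a i * h ^+ i =
    f (w + h) - \sum_(i < m.+1) a i * h ^+ i + a m * h ^+ m.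
  by rewrite big_ord_recr /= opprD addrA subrK.
apply: le_trans (le_normcD _ _) _; rewrite mulrDl lerD//; last by rewrite normcM normcX.
apply: le_trans (H _ hd) _; rewrite ler_wpM2l// exprS.
by rewrite ler_piMl ?exprn_ge0 ?normc_ge0// ltW.
Qed.

Lemma taylor_shift_sub (R : realType) m (f : R[i] -> R[i]) z w c :
  taylor m.+1 f (z + w) -> taylor m.+1 (fun h => f (z + h) - c) w.
Proof.
move=> [a [B [d [d0 B0 H]]]].
exists (fun i => if i is 0%N then a 0%N - c else a i), B, d; split => // h hd.
have := H h hd; rewrite !big_ord_recl /= !expr0 !mulr1 addrA.
by congr (normc _ <= _); ring.
Qed.

(** The expansion of the quotient at [w <> 0] solves
    [(w + h) * (b0 + b1 * h + b2 * h ^ 2) = a0 + a1 * h + a2 * h ^ 2] up to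
    [b2 * h ^ 3]. *)
Lemma taylor_quot (R : realType) (F g : R[i] -> R[i]) w : w != 0 ->
  (forall h, h != 0 -> g h = F h / h) -> taylor 3 F w -> taylor 3 g w.
Proof.
move=> w0 gE [a [B [d [d0 B0 H]]]].
have nw := normc_gt0 w0.
pose b0 := a 0%N / w; pose b1 := (a 1%N - b0) / w; pose b2 := (a 2%N - b1) / w.
exists (fun i => nth 0 [:: b0; b1; b2] i), ((B + normc b2) / (normc w / 2)),
  (Order.min d (normc w / 2)); split.
- by rewrite lt_min d0 divr_gt0.
- by rewrite divr_ge0 ?addr_ge0 ?divr_ge0 ?normc_ge0.
move=> h; rewrite lt_min => /andP[hd hw].
have wh : normc w / 2 <= normc (w + h).
  have := le_normcB w (- h); rewrite opprK normcN; lra.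
have wh0 : w + h != 0.
  by apply: contraTneq wh => ->; rewrite normc0 -ltNge divr_gt0.
have := H h hd; rewrite !big_ord_recl !big_ord0 /= gE// => Hh.
rewrite /bump/= in Hh *.
set r := F (w + h) - _ in Hh.
have -> : F (w + h) / (w + h) - (b0 * h ^+ 0 + (b1 * h ^+ 1 + (b2 * h ^+ 2 + 0)))
   = (r - b2 * h ^+ 3) / (w + h).
  by rewrite /r /b2 /b1 /b0 /=; field; apply/andP.
rewrite normcM normcV [leRHS]mulrAC ler_pdivlMr ?divr_gt0//.
apply: le_trans (_ : (normc (r - b2 * h ^+ 3) / normc (w + h)) * normc (w + h) <= _).
  by rewrite ler_wpM2l// divr_ge0 ?normc_ge0.
rewrite divfK; last by rewrite gt_eqF// (lt_le_trans _ wh)// divr_gt0.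
apply: le_trans (le_normcD _ _) _; rewrite mulrDl lerD//.
by rewrite normcN normcM normcX.
Qed.

(** At the removable singularity one order is lost: the expansion of [F] is
    divided by [h], and the value to insert is the first coefficient of [F]. *)
Lemma taylor_quot0 (R : realType) (F : R[i] -> R[i]) : F 0 = 0 -> taylor 4 F 0 ->
  exists c, taylor 3 (fun h => if h == 0 then c else F h / h) 0.
Proof.
move=> F0 [a [B [d [d0 B0 H]]]].
have a0 : a 0%N = 0 by rewrite -(taylor_coef0 d0 H).
exists (a 1%N); exists (fun i => a i.+1), B, d; split => // h hd.
have := H h hd; rewrite !add0r big_ord_recl a0 mul0r add0r.
have [->|h0] := eqVneq h 0.
  move=> _; rewrite big_ord_recl big1 => [|i _]; last by rewrite exprS mul0r mulr0.
  by rewrite addr0 expr0 mulr1 subrr normc0 expr0n mulr0.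
have nh := normc_gt0 h0.
have -> : F h - \sum_(i < 3) a (lift ord0 i) * h ^+ lift ord0 i =
    (F h / h - \sum_(i < 3) a i.+1 * h ^+ i) * h.
  rewrite mulrBl divfK// mulr_suml; congr (_ - _); apply: eq_bigr => i _.
  by rewrite -mulrA -exprSr.
by rewrite normcM exprSr mulrA ler_pM2r.
Qed.

(** The maximum principle for the quotient [F w / w], which is at most [M / s] on
    the circle of radius [s]. *)
Lemma schwarz (R : realType) (F : R[i] -> R[i]) (s M : R) : 0 < s -> F 0 = 0 ->
  (forall w, normc w <= s -> taylor 4 F w) ->
  (forall w, normc w <= s -> normc (F w) <= M) ->
  forall w, normc w <= s -> normc (F w) <= M / s * normc w.
Proof.
move=> s0 F0 TF FM w ws.
have [c Tc] := taylor_quot0 F0 (TF 0 ltac:(by rewrite normc0 ltW)).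
set g := (fun h => _) in Tc.
have gE h : h != 0 -> g h = F h / h by rewrite /g => /negbTE ->.
have Tg z : normc z <= s -> taylor 3 g z.
  have [-> //|z0 zs] := eqVneq z 0.
  exact: (taylor_quot z0 gE (taylor_weaken (TF _ zs))).
have [->|w0] := eqVneq w 0; first by rewrite F0 normc0 mulr0.
rewrite -ler_pdivrMr ?normc_gt0// -normcV -normcM -gE//.
apply: (max_principle s0 Tg) ws => z zs.
have z0 : z != 0 by apply: contraTneq s0 => z0; rewrite -zs z0 normc0 ltxx.
by rewrite gE// normcM normcV zs ler_pM2r ?invr_gt0// FM ?zs.
Qed.

(** * Expansions of analytic functions *)

Lemma near_normc (R : realType) (z0 : R[i]^o) (A : set R[i]^o) :
  (\forall z \near z0, A z) ->
  exists2 r : R, 0 < r & forall z : R[i], normc (z - z0) < r -> A z.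
Proof.
move=> /nbhs_ballP[[e e'] /=]; rewrite ltcE /= => /andP[/eqP H e0] H'.
exists e => // z zz; apply: H'; rewrite /ball /= distrC.
by rewrite normc_def ltcE /= H eqxx /=; case: (z - z0) zz.
Qed.

Lemma cvg_normc (R : realType) (u : nat -> R[i]^o) (l : R[i]^o) : u @ \oo --> l ->
  forall e : R, 0 < e -> \forall n \near \oo, normc (u n - l) < e.
Proof.
move=> ul e e0.
have e0' : (0 : R[i]) < e%:C by rewrite ltcR.
move/cvgrPdist_lt : ul => /(_ _ e0').
by apply: filterS => n; rewrite distrC normc_def ltcR; case: (u n - l).
Qed.

Lemma cvg_series_bounded (R : realType) (u : nat -> R[i]^o) (l : R[i]^o) :
  series u @ \oo --> l -> exists2 B, 0 <= B & forall n, normc (u n) <= B.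
Proof.
move=> /cvg_normc/(_ _ ltr01)[N _ HN].
exists (2 + \sum_(i < N) normc (u i)) => [|n].
  by rewrite addr_ge0// sumr_ge0// => i _; exact: normc_ge0.
have [nN|Nn] := ltnP n N.
  rewrite (bigD1 (Ordinal nN)) //= addrCA lerDl addr_ge0// sumr_ge0// => i _.
  exact: normc_ge0.
apply: (@le_trans _ _ 2); last by rewrite lerDl sumr_ge0// => i _; exact: normc_ge0.
have -> : u n = (series u n.+1 - l) - (series u n - l).
  by rewrite /series /= big_nat_recr //= opprB addrA subrK addrAC subrr add0r.
apply: le_trans (le_normcD _ _) _; rewrite normcN.
have := HN n Nn; have := HN n.+1 (leqW Nn) => /= ? ?; lra.
Qed.

Lemma geometric_le2 (R : realType) (x : R) n : 0 <= x <= 1 / 2 -> \sum_(i < n) x ^+ i <= 2.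
Proof.
move=> /andP[x0 x1].
have := subrX1 x n; have : 0 <= x ^+ n by rewrite exprn_ge0.
have : 0 <= \sum_(i < n) x ^+ i by rewrite sumr_ge0// => i _; rewrite exprn_ge0.
move: (\sum_(_ < _) _) (x ^+ n) => S y; nra.
Qed.

(** Convergence at the single point at distance [h0 = r / 2] bounds
    [|a n| * h0 ^ n], so for [|h| <= h0 / 2] the tail of the series is dominated by
    a geometric series of ratio at most [1 / 2]. *)
Lemma analytic_taylor (R : realType) (f : R[i] -> R[i]) w m :
  analytic_on (@unit_disc R) f -> normc w < 1 -> taylor m f w.
Proof.
move=> af w1.
have [|a /near_normc[r r0 H]] := af w.
  by move: w1; rewrite /unit_disc /= normc_def ltcR; case: w.
pose h0 := r / 2.
have h00 : 0 < h0 by rewrite divr_gt0.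
have [|B0 B00 HB0] := @cvg_series_bounded R (fun n => a n * h0%:C ^+ n) (f (w + h0%:C)).
  have := H (w + h0%:C); rewrite addrAC subrr add0r; apply.
  by rewrite normc_real gtr0_norm// /h0; lra.
have {}HB0 n : normc (a n) * h0 ^+ n <= B0.
  by have := HB0 n; rewrite normcM normcX normc_real gtr0_norm.
exists a, (B0 / h0 ^+ m * 2), (h0 / 2); split.
- by rewrite divr_gt0.
- by rewrite mulr_ge0 ?divr_ge0// exprn_ge0// ltW.
move=> h hh.
(* [f (w + h)] is only a limit of partial sums, hence the extra [e]. *)
apply/ler_addgt0Pr => e e0.
have := H (w + h); rewrite addrAC subrr add0r => Hh.
have {Hh} /cvg_normc/(_ _ e0)[N _ HN] := Hh ltac:(rewrite /h0 in hh; lra).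
have := HN (m + N)%N (leq_addl _ _); rewrite /= normcB => {HN}.
rewrite /series /= big_mkord big_split_ord /=.
set S := \sum_(i < m) _; set T := \sum_(i < N) _ => HN.
have -> : f (w + h) - S = (f (w + h) - (S + T)) + T by ring.
apply: le_trans (le_normcD _ _) _; rewrite addrC lerD ?(ltW HN)//.
pose x := normc h / h0.
have x0 : 0 <= x by rewrite divr_ge0 ?normc_ge0// ltW.
have x1 : x <= 1 / 2 by rewrite ler_pdivrMr//; lra.
apply: (@le_trans _ _ (B0 * x ^+ m * \sum_(i < N) x ^+ i)); last first.
  rewrite [leRHS](_ : _ = B0 * x ^+ m * 2).
    by rewrite ler_wpM2l ?geometric_le2 ?x0// mulr_ge0// exprn_ge0.
  rewrite /x (expr_div_n (normc h)); move: (h0 ^+ m)^-1 (normc h ^+ m) => p y; ring.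
apply: le_trans (le_normc_sum _ _ _) _; rewrite mulr_sumr ler_sum// => i _.
rewrite -mulrA -exprD normcM normcX /x (expr_div_n (normc h)) [leRHS]mulrCA [leLHS]mulrC.
apply: ler_wpM2l; first by rewrite exprn_ge0 ?normc_ge0.
by rewrite ler_pdivlMr ?exprn_gt0.
Qed.

(** * Growth from a lower bound on squares *)

(** The increment of [f] is bounded by [2 * T * |f w0|] within distance [s], so by
    the Schwarz lemma by [|f w0| / 2] within distance [s / (4 * T)]. *)
Lemma half_peak (R : realType) (f : R[i] -> R[i]) (w0 : R[i]) (s T : R) :
  analytic_on (@unit_disc R) f -> 0 < s -> normc w0 + s < 1 -> 1 <= T ->
  (forall h, normc h <= s -> normc (f (w0 + h)) <= T * normc (f w0)) ->
  forall h, normc h <= s / (4 * T) -> normc (f w0) / 2 <= normc (f (w0 + h)).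
Proof.
move=> af s0 ws T1 HT h hs.
have T0 : 0 < T by lra.
have hs' : normc h <= s.
  by apply: le_trans hs _; rewrite ler_pdivrMr ?mulr_gt0// ler_peMr//; lra.
have f0 := normc_ge0 (f w0).
have FM w : normc w <= s -> normc (f (w0 + w) - f w0) <= 2 * T * normc (f w0).
  move=> wle; apply: le_trans (le_normcD _ _) _; rewrite normcN.
  have := HT w wle; nra.
have TF w : normc w <= s -> taylor 4 (fun h => f (w0 + h) - f w0) w.
  move=> wle; apply: taylor_shift_sub; apply: analytic_taylor => //.
  by apply: le_lt_trans (le_normcD _ _) _; lra.
have F0 : f (w0 + 0) - f w0 = 0 by rewrite addr0 subrr.
have := schwarz s0 F0 TF FM hs'.
have half : 2 * T * normc (f w0) / s * normc h <= normc (f w0) / 2.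
  apply: (@le_trans _ _ (2 * T * normc (f w0) / s * (s / (4 * T)))).
    by rewrite ler_wpM2l// divr_ge0 ?(ltW s0)// mulr_ge0// ; lra.
  by rewrite le_eqVlt; apply/orP; left; apply/eqP; field; rewrite !gt_eqF.
have := le_normcB (f w0) (f (w0 + h)); rewrite normcB; lra.
Qed.

(** The hypothesis on squares is what integrability of [|f| ^ q] gives, in a form
    free of measures: [A] is a multiple of the integral. The exponent [K] is such that
    [(s ^ K) ^ q <= s ^ 2] for [s <= 1], which turns a bound on [|f w0| ^ q * s ^ 2]
    into one on [|f w0| * s ^ K]. *)
Lemma disc_growth (R : realType) (f : R[i] -> R[i]) (q A : R) (K : nat) :
  analytic_on (@unit_disc R) f -> 0 < q -> 2 <= K%:R * q ->
  (forall w0 e c, 0 < e -> 0 <= c ->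
     (forall x y : R, `|x| <= e -> `|y| <= e ->
        normc (w0 + (x +i* y)) < 1 /\ c <= normc (f (w0 + (x +i* y)))) ->
     c `^ q * e ^+ 2 <= A) ->
  exists C, forall z, normc z < 1 -> normc (f z) * (1 - normc z) ^+ K <= C.
Proof.
move=> af q0 Kq HA.
have A0 : 0 <= A.
  have := HA 0 (1 / 4) 0 ltac:(lra) (lexx _).
  rewrite powR0 ?gt_eqF// mul0r; apply => x y xe ye; rewrite add0r normc_ge0; split => //.
  by apply: le_lt_trans (normc_le_re_im _ _) _; lra.
(* With [K > 0] the weight vanishes on the circle of radius [rho]. *)
have K0 : (0 < K)%N by case: K Kq {HA}; rewrite // mul0r; lra.
(* The fraction of [s] given by [half_peak] for [T = 2 ^ K]. *)
pose k : R := (4 * 2 ^+ K)^-1.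
have k0 : 0 < k by rewrite invr_gt0 mulr_gt0// exprn_gt0.
pose C0 := 2 ^+ K.+1 * (A / (k / 2) ^+ 2) `^ q^-1.
have C00 : 0 <= C0 by rewrite mulr_ge0 ?powR_ge0// exprn_ge0.
suff main rho : 0 < rho < 1 -> forall w, normc w <= rho ->
    normc (f w) * (rho - normc w) ^+ K <= C0.
  (* [C0] is independent of [rho], so [rho] may follow [z]. *)
  exists (2 ^+ K * C0) => z z1; have z0 := normc_ge0 z.
  have := main ((1 + normc z) / 2) ltac:(apply/andP; split; lra) z ltac:(lra).
  have -> : (1 + normc z) / 2 - normc z = (1 - normc z) / 2 by field.
  by rewrite expr_div_n mulrA ler_pdivrMr ?exprn_gt0// (mulrC C0).
move=> /andP[rho0 rho1] w wr.
pose u (w : R[i]) := normc (f w) * (rho - normc w) ^+ K.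
rewrite -/(u w).
have [w0 w0r maxu] : exists2 w0, normc w0 <= rho & forall w, normc w <= rho -> u w <= u w0.
  apply: disc_max => [|z zs]; first exact: ltW.
  apply: cvgM.
    apply: (@taylor_continuous _ 0); apply: analytic_taylor => //.
    exact: le_lt_trans zs _.
  apply: (@cvg_comp _ _ _ (fun w => rho - normc (cplx w)) (fun x => x ^+ K)).
    by apply: cvgB; [exact: cvg_cst|exact: continuous_normc].
  exact: exprn_continuous.
apply: le_trans (maxu _ wr) _.
have f0 := normc_ge0 (f w0); have nw0 := normc_ge0 w0.
have [w0lt|w0ge] := ltP (normc w0) rho; last first.
  have -> : u w0 = 0; last by [].
  by rewrite /u (_ : normc w0 = rho) ?subrr ?expr0n ?gtn_eqF ?mulr0//; apply/le_anti/andP.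
pose s := (rho - normc w0) / 2.
have s0 : 0 < s by rewrite divr_gt0// subr_gt0.
have H h : normc h <= s -> normc (f (w0 + h)) <= 2 ^+ K * normc (f w0).
  move=> hs; have wh := le_normcD w0 h.
  have : u (w0 + h) <= u w0 by apply: maxu; rewrite /s in hs; lra.
  rewrite /u (_ : rho - normc w0 = 2 * s); last by rewrite /s; field.
  rewrite exprMn mulrCA mulrA => uu.
  rewrite -(@ler_pM2r _ (s ^+ K)) ?exprn_gt0//; apply: le_trans uu.
  have := le_normcD w0 h; rewrite /s in hs s0 *; move=> wh'.
  by rewrite ler_wpM2l ?normc_ge0// lerXn2r ?nnegrE; lra.
have T1 : 1 <= 2 ^+ K :> R by rewrite exprn_ege1// ler1n.
have T0 : 0 < 2 ^+ K :> R by rewrite exprn_gt0.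
have sk : s / (4 * 2 ^+ K) = k * s by rewrite mulrC.
have ws1 : normc w0 + s < 1 by rewrite /s; lra.
have lower := half_peak af s0 ws1 T1 H; rewrite sk in lower.
have s1 : s <= 1 by rewrite /s; lra.
have ks : 0 < k * s by rewrite mulr_gt0.
have k1 : k <= 1 / 4.
  by rewrite /k invfM mul1r ler_piMr ?invr_ge0// invf_le1.
have := HA w0 (k * s / 2) (normc (f w0) / 2) ltac:(lra) ltac:(lra).
have square x y : `|x| <= k * s / 2 -> `|y| <= k * s / 2 ->
    normc (w0 + x +i* y) < 1 /\ normc (f w0) / 2 <= normc (f (w0 + x +i* y)).
  move=> xk yk; have xy := normc_le_re_im x y.
  split; last by apply: lower; lra.
  by apply: le_lt_trans (le_normcD _ _) _; nra.
move=> /(_ square); set n := normc (f w0) in f0 *.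
have uE : u w0 = 2 ^+ K.+1 * (n / 2 * s ^+ K).
  by rewrite /u (_ : rho - normc w0 = 2 * s) -?/n ?exprMn ?exprS; [field|rewrite /s; field].
have n20 : 0 <= n / 2 by rewrite divr_ge0.
have sK : (s ^+ K) `^ q <= s ^+ 2.
  rewrite -powR_mulrn ?(ltW s0)// -powRrM -[leRHS]powR_mulrn ?(ltW s0)//.
  by apply: ger_powR => //; rewrite s0 s1.
move=> bound.
have {}bound : (n / 2 * s ^+ K) `^ q <= A / (k / 2) ^+ 2.
  rewrite ler_pdivlMr ?exprn_gt0 ?divr_gt0// powRM ?exprn_ge0// ?(ltW s0)//.
  apply: le_trans bound; rewrite -[leLHS]mulrA ler_wpM2l ?powR_ge0//.
  rewrite (_ : k * s / 2 = s * (k / 2)); last by ring.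
  by rewrite [leRHS]exprMn ler_wpM2r// exprn_ge0// divr_ge0// ltW.
rewrite uE /C0 ler_wpM2l ?exprn_ge0//.
have nn : 0 <= n / 2 * s ^+ K by rewrite mulr_ge0// exprn_ge0// ltW.
have -> : n / 2 * s ^+ K = ((n / 2 * s ^+ K) `^ q) `^ q^-1.
  by rewrite -powRrM mulfV ?gt_eqF// powRr1.
apply: ge0_ler_powR => //; first by rewrite invr_ge0 ltW.
- by rewrite nnegrE powR_ge0.
- by rewrite nnegrE divr_ge0 ?sqr_ge0.
Qed.


(** * Integrals of arbitrary nonnegative functions *)

(** An analytic function is unconstrained off the disc, so the integrands
    need not be measurable on the whole plane. The integral is then the supremum over
    simple minorants, for which the two inequalities below persist. *)
Section arbitrary_integrands.
Local Open Scope ereal_scope.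
Context d (T : measurableType d) (R : realType).
Variable mu : {measure set T -> \bar R}.

Lemma ge0_le_integral_any (F G : T -> \bar R) : (forall x, 0 <= F x) ->
  (forall x, F x <= G x) -> \int[mu]_x F x <= \int[mu]_x G x.
Proof.
move=> F0 FG.
have G0 x : 0 <= G x by apply: le_trans (FG x).
rewrite !ge0_integralTE//; apply: ge_ereal_sup => _ [h hF <-].
by apply: ereal_sup_ubound; exists h => // x; apply: le_trans (FG x).
Qed.

Lemma integral_le_add_any (F G : T -> \bar R) : (forall x, 0 <= F x) ->
  (forall x, 0 <= G x) -> measurable_fun setT G ->
  \int[mu]_x (F x + G x) <= \int[mu]_x F x + \int[mu]_x G x.
Proof.
move=> F0 G0 mG.
have FG0 x : 0 <= F x + G x by rewrite adde_ge0.
rewrite [leLHS]ge0_integralTE//; apply: ge_ereal_sup => _ [h hFG <-].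
have mh : measurable_fun setT (EFin \o h) by exact/measurable_EFinP.
have -> : sintegral mu h = \int[mu]_x (h x)%:E.
  by rewrite integral_nnsfun// patch_setT.
(* A simple minorant [h] of [F + G] is at most [k + G] with [k] measurable and
   at most [F]. *)
pose k x := maxe ((h x)%:E - G x) 0.
have mk : measurable_fun setT k.
  by apply: measurable_maxe; [exact: emeasurable_funB|exact: measurable_cst].
have k0 x : 0 <= k x by rewrite le_max lexx orbT.
apply: (@le_trans _ _ (\int[mu]_x (k x + G x))).
  apply: ge0_le_integral_any => x; first by rewrite lee_fin.
  rewrite /k; have := G0 x; case: (G x) => [r| |] //= r0.
  - by rewrite -EFinB -EFin_max -EFinD lee_fin -lerBlDr le_max lexx.
  - by rewrite addey ?leey//= max_r ?leNye.
rewrite ge0_integralD// leeD2r//.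
apply: ge0_le_integral_any => // x.
rewrite /k; have := G0 x; have := hFG x; case: (G x) => [r| |] //=.
  by move=> hF r0; rewrite ge_max; apply/andP; split; [rewrite EFinN leeBlDr|exact: F0].
by move=> _ _; rewrite addeNy ge_max; apply/andP; split; [exact: leNye|exact: F0].
Qed.

End arbitrary_integrands.

(** * Normalized area *)

Lemma lebesgue_itvcc {R : realType} (a b : R) : a <= b ->
  lebesgue_measure (`[a, b]%classic : set R) = (b - a)%:E.
Proof.
move=> ab; rewrite lebesgue_measure_itv /= lte_fin lt_neqAle ab andbT EFinD.
by case: eqVneq => //= ->; rewrite -EFinD subrr.
Qed.

Lemma lebesgue_box {R : realType} (a b c d : R) : a <= b -> c <= d ->
  (lebesgue_measure \x lebesgue_measure)%E (`[a, b]%classic `*` `[c, d]%classic)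
    = ((b - a) * (d - c))%:E.
Proof.
move=> ab cd.
rewrite [LHS](@product_measure1E _ _ _ _ _ lebesgue_measure lebesgue_measure) //.
by rewrite EFinM; congr (_ * _)%E; exact: lebesgue_itvcc.
Qed.

Section normalized_area.
Context {R : realType}.
Notation dA := (@dA R).

Lemma dAE A :
  dA A = ((1 / pi)%:E * (lebesgue_measure \x lebesgue_measure)%E (A `&` @disc2 R))%E.
Proof. by []. Qed.

Lemma dA_fin : (dA setT < +oo)%E.
Proof.
rewrite dAE setTI.
have sub : @disc2 R `<=` `[-1, 1]%classic `*` `[-1, 1]%classic.
  rewrite disc2E => -[x y] /= xy; split; rewrite /= in_itv /= -ler_norml.
    by rewrite -(@ler_pXn2r _ 2)// ?nnegrE// real_normK ?num_real// expr1n;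
      have := sqr_ge0 y; lra.
  by rewrite -(@ler_pXn2r _ 2)// ?nnegrE// real_normK ?num_real// expr1n;
    have := sqr_ge0 x; lra.
apply: lte_mul_pinfty => //.
  by rewrite lee_fin divr_ge0// pi_ge0.
apply: le_lt_trans (le_measure _ _ _ sub) _; rewrite ?inE//.
- exact: measurable_disc2.
- exact: measurableX.
by rewrite [ltLHS]lebesgue_box ?ltry//; lra.
Qed.

Definition annulus (a b : R) : set (measurableTypeR R * measurableTypeR R) :=
  [set w | a < normc (cplx w) < b].

Lemma measurable_annulus a b : measurable (annulus a b).
Proof.
have mf : measurable_fun [set: measurableTypeR R * measurableTypeR R]
    (fun w => Num.sqrt (w.1 ^+ 2 + w.2 ^+ 2) : R).
  apply: (@measurableT_comp _ _ _ _ _ _ (@Num.sqrt R)).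
    by apply: continuous_measurable_fun; exact: sqrt_continuous.
  by apply: measurable_funD; apply: measurable_funX;
    [exact: measurable_fst|exact: measurable_snd].
have := mf measurableT `]a, b[%classic (measurable_itv _).
by rewrite setTI; congr (measurable _); apply/seteqP; split => w /=; rewrite in_itv.
Qed.

(** The open annuli with fixed inner radius decrease to the empty set as the outer
    radius tends to the inner one, so their areas tend to [0]. *)
Lemma thin_annulus (a eta e : R) : 0 < eta -> 0 < e ->
  exists d, [/\ 0 < d, d <= eta & (dA (annulus a (a + d)) <= e%:E)%E].
Proof.
move=> eta0 e0.
pose F n := annulus a (a + eta / n.+1%:R).
have F0 : \bigcap_n F n = set0.
  rewrite -subset0 => w Fw.
  have /andP[aw _] := Fw 0%N I.
  have /ltr_add_invr[N] : 0 < (normc (cplx w) - a) / eta by rewrite divr_gt0// subr_gt0.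
  rewrite add0r ltr_pdivlMr// mulrC => HN.
  have /andP[_] := Fw N I; rewrite -ltrBlDl => wb.
  by have := lt_trans HN wb; rewrite ltxx.
have : dA (F n) @[n --> \oo] --> (0%:E : \bar R).
  rewrite (_ : 0%:E = dA (\bigcap_n F n)); last by rewrite F0 measure0.
  apply: nonincreasing_cvg_mu.
  - by apply: le_lt_trans dA_fin; apply: le_measure; rewrite ?inE//; exact: measurable_annulus.
  - by move=> i; exact: measurable_annulus.
  - by rewrite F0.
  - move=> n m nm; apply/subsetPset => w /andP[wa wb]; apply/andP; split => //.
    apply: lt_le_trans wb _; rewrite lerD2l ler_wpM2l ?(ltW eta0)//.
    by rewrite lef_pV2 ?posrE// ler_nat ltnS.
move=> /fine_cvgP[_] /cvgrPdist_lt/(_ _ e0)[N _ /(_ N (leqnn _))] /=.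
rewrite sub0r normrN => H.
have FNfin : (dA (F N) \is a fin_num)%E.
  rewrite ge0_fin_numE//; apply: le_lt_trans dA_fin.
  by apply: le_measure; rewrite ?inE//; exact: measurable_annulus.
exists (eta / N.+1%:R); split; first by rewrite divr_gt0.
  by rewrite ler_pdivrMr// ler_peMr ?(ltW eta0)// ler1n.
rewrite -[leLHS]fineK// lee_fin ltW//; apply: le_lt_trans H; exact: ler_norm.
Qed.

End normalized_area.

(** * Growth of Bergman functions *)

Lemma bergman_growth {R : realType} (f : R[i] -> R[i]) (q : R) (K : nat) :
  0 < q -> 2 <= K%:R * q -> bergman (fun=> q) f ->
  exists2 C, 0 <= C & forall z, normc z < 1 -> normc (f z) * (1 - normc z) ^+ K <= C.
Proof.
move=> q0 Kq [af fin].
set I := (\int[_]_w _)%E in fin.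
have I0 : (0 <= I)%E by apply: integral_ge0 => w _; rewrite lee_fin powR_ge0.
have [|C HC] := @disc_growth R f q (pi / 4 * fine I) K af q0 Kq; last first.
  exists C => //; apply: le_trans (HC 0 _); last by rewrite normc0.
  by rewrite normc0 subr0 expr1n mulr1 normc_ge0.
move=> [x0 y0] e c e0 c0 H.
pose Q : set (measurableTypeR R * measurableTypeR R) :=
  `[x0 - e, x0 + e]%classic `*` `[y0 - e, y0 + e]%classic.
have mQ : measurable Q by exact: measurableX.
have HQ w : Q w -> normc (cplx w) < 1 /\ c <= normc (f (cplx w)).
  case: w => x y [/=]; rewrite !in_itv /= => xe ye.
  have := H (x - x0) (y - y0); rewrite !ler_norml.
  have -> : (x0 +i* y0) + ((x - x0) +i* (y - y0)) = cplx (x, y).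
    by rewrite [LHS]/GRing.add /=; congr (_ +i* _); rewrite addrCA subrr addr0.
  by apply; [move: xe|move: ye] => /andP[? ?]; apply/andP; split; lra.
have dAQ : dA Q = (1 / pi * (4 * e ^+ 2))%:E.
  rewrite dAE setIidl => [|w Qw]; last first.
    by have [+ _] := HQ w Qw; rewrite /disc2 /unit_disc /= normc_def ltcR.
  rewrite lebesgue_box; [|lra|lra].
  by rewrite -EFinM; congr (_%:E); ring.
have : ((c `^ q * (1 / pi * (4 * e ^+ 2)))%:E <= I)%E.
  rewrite EFinM -dAQ.
  have -> : (dA Q = \int[dA]_w (\1_Q w)%:E)%E by rewrite integral_indic// setIT.
  rewrite -ge0_integralZl//; last first.
  - by rewrite lee_fin powR_ge0.
  - exact/measurable_EFinP/measurable_indic.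
  apply: ge0_le_integral_any => w; first by rewrite -EFinM lee_fin mulr_ge0 ?powR_ge0.
  rewrite -EFinM lee_fin indicE.
  have [/set_mem Qw|_] := boolP (w \in Q); last by rewrite mulr0 powR_ge0.
  rewrite mulr1; apply: ge0_ler_powR; rewrite ?nnegrE ?normc_ge0 ?(ltW q0)//.
  by have [] := HQ w Qw.
rewrite -[I]fineK ?ge0_fin_numE// lee_fin => HI.
have pi0 := pi_gt0 R.
rewrite -(@ler_pM2l _ (4 / pi)) ?divr_gt0//; apply: le_trans (le_trans HI _).
  by rewrite le_eqVlt mulrCA mul1r; apply/orP; left; apply/eqP; ring.
by rewrite !mulrA divfK ?gt_eqF// divff// mul1r.
Qed.

(** * The exponent with thin rings *)

Lemma limf_esup_eq {R : realType} (g : R -> R) (F : set_system R) (P : R) :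
  F setT -> (forall r, g r <= P) -> (forall V, F V -> exists2 r, V r & g r = P) ->
  limf_esup (fun r => (g r)%:E) F = P%:E.
Proof.
move=> FT gP HV; rewrite limf_esupE; apply/le_anti/andP; split.
  apply: (@le_trans _ _ (ereal_sup [set (g r)%:E | r in setT])).
    by apply: ereal_inf_lbound; exists setT.
  by apply: ge_ereal_sup => _ [r _ <-]; rewrite lee_fin.
apply: le_ereal_inf_tmp => _ [V FV <-].
have [r Vr gr] := HV _ FV.
by apply: ereal_sup_ubound; exists r => //; rewrite gr.
Qed.

Section ring_exponent.
Context {R : realType}.
Variables (q P : R) (d : nat -> R).
Definition ring_start (m : nat) : R := 1 - (2 ^+ m)^-1.

Definition ring_radii : set R := [set r | exists m, ring_start m < r < ring_start m + d m].

Definition ring_exponent (z : R[i]) : R := if `[< ring_radii (normc z) >] then P else q.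

Hypotheses (hq : 0 < q) (hP : q < P).
Hypothesis d0 : forall m, 0 < d m.
Hypothesis d1 : forall m, d m <= (2 ^+ m.+1)^-1.

Lemma ring_exponent_ge z : q <= ring_exponent z.
Proof. by rewrite /ring_exponent; case: ifP => // _; exact: ltW. Qed.

Lemma ring_exponent_le z : ring_exponent z <= P.
Proof. by rewrite /ring_exponent; case: ifP => // _; exact: ltW. Qed.

Lemma ring_exponent_radial : radial ring_exponent.
Proof.
move=> z _; rewrite /ring_exponent normc_def normc_real ger0_norm ?sqrtr_ge0//.
by case: z.
Qed.

Lemma ring_exponent_variable_exponent : variable_exponent ring_exponent.
Proof.
split.
- apply: measurable_funTS.
  pose A : set (measurableTypeR R * measurableTypeR R) :=
    \bigcup_m annulus (ring_start m) (ring_start m + d m).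
  have mA : measurable A by apply: bigcup_measurable => m _; exact: measurable_annulus.
  have -> : ring_exponent \o @cplx R = (fun w => if w \in A then P else q).
    apply/funext => w /=; rewrite /ring_exponent; congr (if _ then _ else _).
    apply/idP/idP => [/asboolP[m Hm]|/set_mem[m _ Hm]].
      by apply/mem_set; exists m.
    by apply/asboolP; exists m.
  apply: measurable_fun_ifT => //.
  apply: (@measurable_fun_bool _ _ _ _ true); rewrite setTI.
  rewrite (_ : _ @^-1` _ = A)//; apply/seteqP; split => w /=; first by move/set_mem.
  by move=> Aw; apply/mem_set.
- apply: (@lt_le_trans _ _ q%:E); first by rewrite lte_fin.
  by apply/ess_infP; apply: nearW => w; rewrite lee_fin ring_exponent_ge.
- apply: (@le_lt_trans _ _ P%:E); last by rewrite ltry.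
  by apply/ess_supP; apply: nearW => w; rewrite lee_fin ring_exponent_le.
Qed.

Lemma near1_ring_radii (U : set R) : (1 : R)^'- U ->
  exists m, forall r, ring_start m < r < ring_start m + d m -> U r.
Proof.
rewrite /at_left /= => /nbhs_ballP[e /= e0 H].
have [m me] : exists m, (2 ^+ m : R)^-1 < e.
  have := @near_infty_natSinv_expn_lt R (PosNum e0).
  by case=> N _ /(_ N (leqnn _)) /= h; exists N; rewrite mul1r in h.
exists m => r /andP[r1 r2].
have r3 : r < 1.
  apply: lt_le_trans r2 _; rewrite /ring_start; have := d1 m.
  have : (2 ^+ m.+1)^-1 <= (2 ^+ m)^-1 :> R.
    by rewrite lef_pV2 ?posrE ?exprn_gt0// ler_weXn2l ?ler1n.
  lra.
apply: H => //; rewrite /ball /= ger0_norm ?subr_ge0 ?ltW//.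
rewrite /ring_start in r1; lra.
Qed.

Lemma ring_exponent_in m r : ring_start m < r < ring_start m + d m -> ring_exponent r%:C = P.
Proof.
move=> mr; rewrite /ring_exponent asboolT//; exists m.
rewrite normc_real ger0_norm//; case/andP: mr => mr _; apply: ltW; apply: le_lt_trans mr.
by rewrite subr_ge0 invf_le1 ?exprn_gt0// exprn_ege1// ler1n.
Qed.

Lemma ring_exponent_limsup :
  limf_esup (fun r : R => (ring_exponent r%:C)%:E) (1 : R)^'- = P%:E.
Proof.
apply: limf_esup_eq => [|r|V VF].
- exact: filterT.
- exact: ring_exponent_le.
have [m Hm] := near1_ring_radii VF.
have mid : ring_start m < ring_start m + d m / 2 < ring_start m + d m.
  by have := d0 m => ?; apply/andP; split; lra.
by exists (ring_start m + d m / 2); [exact: Hm|exact: ring_exponent_in mid].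
Qed.

Lemma ring_exponent_ess_limsup :
  limf_esup (fun r : R => (ring_exponent r%:C)%:E) ess_at_left1 = P%:E.
Proof.
apply: limf_esup_eq => [|r|V [U /near1_ring_radii[m Hm] [N [mN N0 UV]]]].
- by exists setT; [exact: filterT|exact: nearW].
- exact: ring_exponent_le.
apply: contrapT => none.
have sub : `]ring_start m, ring_start m + d m[%classic `<=` N.
  move=> r; rewrite /= in_itv /= => mr; apply: UV => VU; apply: none.
  by exists r; [apply: VU; exact: Hm|exact: ring_exponent_in mr].
have : (lebesgue_measure (`]ring_start m, (ring_start m + d m)%R[%classic : set R)
    <= lebesgue_measure N)%E.
  by apply: le_measure; rewrite ?inE.
rewrite [leRHS]N0 lebesgue_measure_itv /= lte_fin ltrDl d0 -EFinD lee_fin.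
by have := d0 m; lra.
Qed.

(** Where [|f| <= 1] the integrand is at most [1], elsewhere it increases with the
    exponent. *)
Lemma bergman_ring_sub : bergman ring_exponent `<=` bergman (fun=> q).
Proof.
move=> f [af fin]; split => //.
pose F (w : R * R) : \bar R := (normc (f (cplx w)) `^ ring_exponent (cplx w))%:E.
have F0 w : (0 <= F w)%E by rewrite lee_fin powR_ge0.
apply: (@le_lt_trans _ _ (\int[dA]_w (F w + 1))%E).
  apply: ge0_le_integral_any => w; first by rewrite lee_fin powR_ge0.
  rewrite -EFinD lee_fin; set x := normc _; have x0 : 0 <= x by exact: normc_ge0.
  have [x1|x1] := leP x 1; last first.
    apply: (@le_trans _ _ (x `^ ring_exponent (cplx w))); last by rewrite lerDl.
    by apply: ler_powR; [exact: ltW|exact: ring_exponent_ge].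
  apply: (@le_trans _ _ 1); last by rewrite lerDr powR_ge0.
  have <- : 1 `^ q = 1 by rewrite powR1.
  by apply: ge0_ler_powR; rewrite ?nnegrE// ltW.
apply: le_lt_trans (integral_le_add_any _ _ _ _) _ => //.
by rewrite lte_add_pinfty// integral_cst// mul1e dA_fin.
Qed.

(** On the ring [m] the growth estimate gives
    [|f| <= C * 2 ^ ((m + 1) * K)], since [1 - |z| >= 2 ^ -(m + 1)] there. The area
    bound makes the contribution of this ring at most [C ^ P / 2 ^ (m + 1)]. *)
Lemma bergman_sub_ring K : 2 <= K%:R * q ->
  (forall m, (dA (annulus (ring_start m) (ring_start m + d m)) <=
      ((2 ^ m.+1)%:R * (2 ^+ (m.+1 * K)) `^ P)^-1%:E)%E) ->
  bergman (fun=> q) `<=` bergman ring_exponent.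
Proof.
move=> Kq dAm f bf; have [af fin] := bf; split => //.
have [C C0 HC] := bergman_growth hq Kq bf.
have P0 : 0 < P by exact: lt_trans hP.
pose F (w : R * R) : \bar R := (normc (f (cplx w)) `^ q)%:E.
have F0 w : (0 <= F w)%E by rewrite lee_fin powR_ge0.
pose b m : R := C `^ P * (2 ^+ (m.+1 * K)) `^ P.
have b0 m : 0 <= b m by rewrite mulr_ge0 ?powR_ge0.
pose A m := annulus (ring_start m) (ring_start m + d m).
(* [F + G] dominates the integrand: [G] is a step function at least [b m] on the
   ring [m]. *)
pose G w : \bar R := (\sum_(m <oo) ((b m)%:E * (\1_(A m) w)%:E))%E.
have t0 m w : (0 <= (b m)%:E * (\1_(A m) w)%:E)%E by rewrite -EFinM lee_fin mulr_ge0.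
have G0 w : (0 <= G w)%E by apply: nneseries_ge0.
have mt m : measurable_fun setT (fun w => (b m)%:E * (\1_(A m) w)%:E)%E.
  apply: measurable_funeM; apply/measurable_EFinP.
  by apply: measurable_indic; exact: measurable_annulus.
have mG : measurable_fun setT G by apply: ge0_emeasurable_sum.
apply: (@le_lt_trans _ _ (\int[dA]_w (F w + G w))%E).
  apply: ge0_le_integral_any => w; first by rewrite lee_fin powR_ge0.
  rewrite /ring_exponent; case: asboolP => [[m mw]|_]; last by rewrite leeDl.
  apply: (@le_trans _ _ (G w)); last by rewrite leeDr.
  have Gb : ((b m)%:E <= G w)%E.
    apply: le_trans (nneseries_lim_ge m.+1 (fun n _ _ => t0 n w)).
    rewrite big_nat_recr//= indicE mem_set// mule1.
    by apply: leeDr; exact: sume_ge0.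
  apply: le_trans Gb; rewrite lee_fin /b -powRM ?exprn_ge0//.
  apply: ge0_ler_powR; rewrite ?nnegrE ?normc_ge0 ?(ltW P0) ?mulr_ge0 ?exprn_ge0//.
  have p2 n : 0 < 2 ^+ n :> R by rewrite exprn_gt0.
  have z1 : (2 ^+ m.+1)^-1 <= 1 - normc (cplx w).
    case/andP: mw => _; rewrite /ring_start; have := d1 m.
    have -> : (2 ^+ m)^-1 = 2 * (2 ^+ m.+1)^-1 :> R.
      by rewrite exprS invfM mulrA divff ?mul1r.
    lra.
  have z0 : 0 < 1 - normc (cplx w) by apply: lt_le_trans z1; rewrite invr_gt0.
  rewrite exprM -ler_pdivrMr ?exprn_gt0//.
  apply: le_trans (HC (cplx w) _); last by rewrite -subr_gt0.
  rewrite ler_wpM2l ?normc_ge0// -exprVn; apply: lerXn2r => //; rewrite nnegrE ?invr_ge0 ltW//.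
apply: le_lt_trans (integral_le_add_any _ _ _ _) _ => //.
rewrite lte_add_pinfty// integral_nneseries//.
apply: (@le_lt_trans _ _ (\sum_(m <oo) (C `^ P / (2 ^ m.+1)%:R)%:E)%E); last first.
  by apply: le_lt_trans (epsilon_trick0 _ _) _; rewrite ?powR_ge0 ?ltry.
apply: lee_nneseries => m _; first by rewrite integral_ge0.
rewrite ge0_integralZl_EFin//; last first.
  by apply/measurable_EFinP/measurable_indic; exact: measurable_annulus.
rewrite integral_indic ?setIT//; last exact: measurable_annulus.
apply: le_trans (lee_wpmul2l _ (dAm m)) _; rewrite ?lee_fin//.
rewrite /b invfM.
have B0 : 0 < (2 ^+ (m.+1 * K)) `^ P :> R by rewrite powR_gt0 ?exprn_gt0.
by rewrite mulrACA mulfV ?mulr1 ?gt_eqF.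
Qed.

End ring_exponent.

Unset Implicit Arguments.

Theorem corollary4p5 (R : realType) (q P : R) (hq : 0 < q) (hP : q < P) :
  exists p : R[i] -> R,
    [/\ variable_exponent p,
        radial p,
        forall r : R, 0 <= r < 1 -> q <= p r%:C,
        limf_esup (fun r : R => (p r%:C)%:E) (1 : R)^'- = P%:E /\
        limf_esup (fun r : R => (p r%:C)%:E) ess_at_left1 = P%:E &
        bergman p = bergman (fun=> q)].
Proof.
have [K Kq] : exists K : nat, 2 <= K%:R * q.
  exists (Num.truncn (2 / q)).+1.
  by rewrite -ler_pdivrMr// ltW// truncnS_gt.
have D m : exists d : R, [/\ 0 < d, d <= (2 ^+ m.+1)^-1 &
    (dA (annulus (ring_start m) (ring_start m + d))
      <= (((2 ^ m.+1)%:R * (2 ^+ (m.+1 * K)) `^ P)^-1)%:E)%E].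
  apply: thin_annulus; first by rewrite invr_gt0 exprn_gt0.
  by rewrite invr_gt0 mulr_gt0 ?ltr0n ?expn_gt0// powR_gt0// exprn_gt0.
have [d Hd] := choice D.
have d0 m : 0 < d m by have [] := Hd m.
have d1 m : d m <= (2 ^+ m.+1)^-1 by have [] := Hd m.
exists (ring_exponent q P d); split.
- exact: ring_exponent_variable_exponent.
- exact: ring_exponent_radial.
- by move=> r _; exact: ring_exponent_ge.
- by split; [exact: ring_exponent_limsup|exact: ring_exponent_ess_limsup].
- apply/seteqP; split; first exact: bergman_ring_sub.
  by apply: bergman_sub_ring Kq _ => // m; have [] := Hd m.
Qed.
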